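(* Let $n \ge 2$, let $K$ be a (non-archimedean) local field, and let $Y_n$ be the graph of special vertices of the affine building $\Delta_n$ of $\mathrm{Sp}_n(K)$. Then $Y_n$ is non-amenable (i.e. not amenable).
   Context: $K$ is a local field with discrete valuation $\mathrm{ord}$, valuation ring $\mathcal{O}$, uniformizer $\pi$, residue field $k\cong\mathbb{F}_q$. $V$ is a $2n$-dimensional $K$-vector space with a non-degenerate alternating bilinear form $\langle\cdot,\cdot\rangle$. A lattice in $V$ is a free rank-$2n$ $\mathcal{O}$-submodule of $V$; lattices $L,L'$ are homothetic if $L'=\alpha L$ for some $\alpha\in K^\times$, and $[L]$ is the homothety class of $L$. A lattice $L$ is primitive if $\langle L,L\rangle\subseteq\mathcal{O}$ and $\langle\cdot,\cdot\rangle$ induces a non-degenerate alternating $k$-bilinear form on $L/\pi L$. The building $\Delta_n$: a vertex of $\Delta_n$ is a homothety class of lattices having a representative $L$ for which there is a primitive lattice $L_0$ with $\langle L,L\rangle\subseteq\pi\mathcal{O}$ and $\pi L_0\subseteq L\subseteq L_0$. Two vertices $t,t'$ are incident if there are representatives $L\in t$, $L'\in t'$ and a primitive lattice $L_0$ with $\langle L,L\rangle\subseteq\pi\mathcal{O}$, $\langle L',L'\rangle\subseteq\pi\mathcal{O}$, and either $\pi L_0\subseteq L\subseteq L'\subseteq L_0$ or $\pi L_0\subseteq L'\subseteq L\subseteq L_0$. Two distinct incident vertices are called adjacent. A basis $\{u_1,\dots,u_n,w_1,\dots,w_n\}$ of $V$ is symplectic if $\langle u_i,w_j\rangle=\delta_{ij}$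 and $\langle u_i,u_j\rangle=0=\langle w_i,w_j\rangle$ for all $i,j$. A vertex $[L]$ of $\Delta_n$ is special if, writing $L=\sum_i\mathcal{O}\pi^{a_i}u_i+\sum_i\mathcal{O}\pi^{b_i}w_i$ in a symplectic basis (with $a_i,b_i\in\mathbb{Z}$), the sum $a_i+b_i$ is the same for all $i$ (this does not depend on the choices). $Y_n$ is the graph whose vertices are the special vertices of $\Delta_n$, two of them being joined by an edge iff they are adjacent in $\Delta_n$. Amenability: let $X$ be a connected graph with infinitely many vertices and of bounded degree. For a connected induced subgraph $X'$ of $X$ with at least one edge, $\sigma(X')$ is the set of vertices of $X'$ adjacent to a vertex of $X$ not in $X'$. $X$ is amenable if $\inf\big(\mathrm{Card}(\sigma(X'))/\mathrm{Card}(X')\big)=0$, the infimum being over all finite connected induced subgraphs $X'$ of $X$ with at least one edge. *)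

(* Defs.v *)
From mathcomp Require Import all_boot all_order all_algebra sesquilinear finmap.
From mathcomp Require Import all_classical reals.

Set Implicit Arguments.
Unset Strict Implicit.
Unset Printing Implicit Defensive.

Import Order.TTheory GRing.Theory Num.Theory.
Local Open Scope classical_set_scope.
Local Open Scope ring_scope.

(** * Non-archimedean local fields *)

Section LocalField.
Variables (K : fieldType) (ord : K -> int).

(* ord 0 is +oo; the integer [ord 0] is never used. For a uniformizer pi this
   set is pi^m O, so that m = 0 gives the valuation ring O and m = 1 its
   maximal ideal pi O. *)
Definition ideal_ord (m : int) : set K := [set x | x = 0 \/ m <= ord x].

Definition val_ring : set K := ideal_ord 0.

Definition is_uniformizer (pi : K) : Prop := pi <> 0 /\ ord pi = 1.

Record is_local_field : Prop := IsLocalField {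
  ordM : forall x y, x <> 0 -> y <> 0 -> ord (x * y) = ord x + ord y;
  ordD : forall x y, x <> 0 -> y <> 0 -> x + y <> 0 ->
    Num.min (ord x) (ord y) <= ord (x + y);
  ord_normalized : exists pi, is_uniformizer pi;
  (* O / pi O is finite: s contains a set of representatives *)
  residue_finite : exists s : seq K,
    forall x, val_ring x -> exists2 r, r \in s & ideal_ord 1 (x - r);
  ord_complete : forall u : nat -> K,
    (forall m : int, exists N : nat, forall i j : nat,
       (N <= i)%N -> (N <= j)%N -> ideal_ord m (u i - u j)) ->
    exists l : K, forall m : int, exists N : nat, forall i : nat,
       (N <= i)%N -> ideal_ord m (u i - l)
}.

End LocalField.

(** * Lattices and the building *)

Section Building.
Variables (K : fieldType) (ord : K -> int) (pi : K).
Variables (V : vectType K) (B : {biscalar V}).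
Implicit Types (L : set V) (t : set (set V)).

Definition alternating : Prop := forall x : V, B x x = 0.

Definition nondegenerate_form : Prop :=
  forall x : V, (forall y, B x y = 0) -> x = 0.

Definition O_span m (e : 'I_m -> V) : set V :=
  [set x | exists2 c : 'I_m -> K,
     (forall i, val_ring ord (c i)) & x = \sum_i c i *: e i].

Definition O_free m (e : 'I_m -> V) : Prop :=
  forall c : 'I_m -> K, (forall i, val_ring ord (c i)) ->
    \sum_i c i *: e i = 0 -> forall i, c i = 0.

Definition is_lattice L : Prop :=
  exists2 e : 'I_(\dim {:V}) -> V, O_free e & L = O_span e.

Definition scale_set (a : K) L : set V := [set a *: x | x in L].

Definition homothety_class L : set (set V) :=
  [set L' | exists2 a : K, a <> 0 & L' = scale_set a L].

(* <L, L> is contained in pi^m O *)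
Definition form_in (m : int) L : Prop :=
  forall x y, L x -> L y -> ideal_ord ord m (B x y).

(* The last clause says that the form induced on L / pi L, with values in
   O / pi O, has trivial radical. *)
Definition is_primitive L : Prop :=
  [/\ is_lattice L, form_in 0 L &
      forall x, L x -> (forall y, L y -> ideal_ord ord 1 (B x y)) ->
        scale_set pi L x].

Definition building_vertex t : Prop :=
  exists L L0,
    [/\ is_lattice L, t = homothety_class L, is_primitive L0, form_in 1 L &
        scale_set pi L0 `<=` L /\ L `<=` L0].

Definition incident t t' : Prop :=
  exists L L' L0,
    [/\ t L /\ t' L', is_primitive L0, form_in 1 L, form_in 1 L' &
        [/\ scale_set pi L0 `<=` L, L `<=` L' & L' `<=` L0] \/
        [/\ scale_set pi L0 `<=` L', L' `<=` L & L `<=` L0]].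

Definition adjacent t t' : Prop := t <> t' /\ incident t t'.

Definition symplectic_basis n (u w : n.-tuple V) : Prop :=
  [/\ basis_of {:V} (u ++ w),
      forall i j, B (tnth u i) (tnth w j) = (i == j)%:R,
      forall i j, B (tnth u i) (tnth u j) = 0 &
      forall i j, B (tnth w i) (tnth w j) = 0].

(* The condition on a and b depends neither on the representative L of t nor
   on the symplectic basis adapted to L. *)
Definition special_vertex n t : Prop :=
  building_vertex t /\
  exists L (u w : n.-tuple V) (a b : 'I_n -> int),
    [/\ t L, symplectic_basis u w,
        L = [set x + y | x in O_span (fun i => pi ^ a i *: tnth u i) &
                         y in O_span (fun i => pi ^ b i *: tnth w i)] &
        forall i j, a i + b i = a j + b j].

End Building.

(** * Graphs and amenability *)

Record graph := Graph {
  vertex :> choiceType;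
  edge : rel vertex;
  edge_sym : symmetric edge;
  edge_irr : irreflexive edge
}.

Section Amenability.
Variable X : graph.
Implicit Types A : {fset X}.

(* A finite induced subgraph of X is given by its set A of vertices. *)
Definition induced_connected A : Prop :=
  forall x y, x \in A -> y \in A ->
    exists p : seq X, [/\ path (@edge X) x p, last x p = y & all (mem A) p].

Definition induced_has_edge A : Prop :=
  exists x y, [/\ x \in A, y \in A & edge x y].

Definition sigma A : {fset X} :=
  [fset x in A | `[< exists2 y, y \notin A & edge x y >]]%fset.

(* To be used for connected infinite graphs X of bounded degree only. *)
Definition amenable (R : realType) : Prop :=
  inf [set (#|` sigma A|%:R / #|` A|%:R : R) |
       A in [set A | induced_connected A /\ induced_has_edge A]] = 0.

End Amenability.

(** * The graph of special vertices *)

Section SpecialGraph.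
Variables (K : fieldType) (ord : K -> int) (pi : K).
Variables (V : vectType K) (B : {biscalar V}) (n : nat).

Definition special_vertices : set (set (set V)) :=
  [set t | special_vertex ord pi B n t].

Definition special_edge : rel special_vertices :=
  fun t t' => `[< adjacent ord pi B (val t) (val t') >].

Lemma special_edge_sym : symmetric special_edge.
Proof.
move=> t t'; apply/asbool_equiv_eq; split=> -[/nesym neq] [L] [L'] [L0].
  by case=> -[tL tL'] pL0 BL BL' chain; split=> //; exists L', L, L0;
     split=> //; case: chain; [right | left].
by case=> -[tL tL'] pL0 BL BL' chain; split=> //; exists L', L, L0;
   split=> //; case: chain; [right | left].
Qed.

Lemma special_edge_irr : irreflexive special_edge.
Proof. by move=> t; apply/asboolP => -[]. Qed.

Definition special_graph : graph := Graph special_edge_sym special_edge_irr.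

End SpecialGraph.

(* Main.v *)
From HB Require Import structures.
Require Import Defs.
From mathcomp Require Import all_boot all_order all_algebra sesquilinear finmap.
From mathcomp Require Import all_classical reals.
From mathcomp Require Import zify ring.

(** The special vertices of the building are the homothety classes of the
lattices L that are self-dual up to scale: for some integer s, L is the set of
the x with <x, L> contained in pi^s O. Up to homothety s is 0 or 1, and the
neighbours of [L] are the classes of the lattices C between pi L and L that
are self-dual for s + 1, that is, of the Lagrangian subspaces of L / pi L.

Fix a Lagrangian subspace U of V. It singles out one neighbour of every vertex
[L], its parent: the class of pi L + (L :&: U), whose image in L / pi L is the
reduction of L :&: U. The parent of a neighbour [C] of [L] is [L] itself as
soon as the Lagrangian C / pi L is a complement of that reduction
([family_child]), and there are at least two such complements
([two_child_lattices]). To exhibit them, one needs a symplectic O-basis u, w of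
L with all u_i in U; this is the Iwasawa decomposition ([Iwasawa]), obtained by
a greedy construction of hyperbolic pairs. The first complement is then
spanned by the w_i, and the second one arises in the same way when w_0 is
replaced with w_0 + u_0.

So every vertex has a single parent and at least two children. Choose two
children of each. The chosen children of a finite set A of vertices are 2 |A|
in number, and at most |A| of them lie in A; the others are children of
boundary vertices, at most two of each, so that |A| <= 2 |sigma A|
([card_le_twice_sigma]). The ratios in the definition of amenability are thus
bounded below by 1/2.
*)

Set Implicit Arguments.
Unset Strict Implicit.
Unset Printing Implicit Defensive.

Import Order.TTheory GRing.Theory Num.Theory.
Local Open Scope classical_set_scope.
Local Open Scope ring_scope.

(** * Graphs in which every vertex is the parent of two others *)

Section Parent.
Variables (X : graph) (T : Type) (parent inc : X -> T).
(* [parent] takes its values in a type larger than X, in which [inc] embeds X: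
   the parent of a vertex need not be known to be a vertex. *)
Hypothesis inc_inj : injective inc.
Hypothesis two_children : forall x, exists y z,
  [/\ edge x y, edge x z, y <> z, parent y = inc x & parent z = inc x].

(** The two children maps f and g are injective with disjoint images, since a
child determines its parent. Hence A has 2 |A| chosen children; those outside
of A, at least |A| of them, are children of vertices of sigma A. *)
Lemma card_le_twice_sigma (A : {fset X}) : (#|` A| <= 2 * #|` sigma A|)%N.
Proof.
have [f fP] := choice two_children.
have [g gP] := choice fP.
have finj : injective f.
  by move=> x y fxy; have [_ _ _ px _] := gP x; have [_ _ _ py _] := gP y;
     apply: inc_inj; rewrite -px -py fxy.
have ginj : injective g.
  by move=> x y gxy; have [_ _ _ _ px] := gP x; have [_ _ _ _ py] := gP y;
     apply: inc_inj; rewrite -px -py gxy.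
have imfC (h : X -> X) (D : {fset X}) : injective h ->
    #|` [fset h x | x in D]%fset| = #|` D|.
  by move=> hinj; rewrite card_imfset.
pose C (D : {fset X}) := ([fset f x | x in D] `|` [fset g x | x in D])%fset.
have CA : (#|` C A| = #|` A| + #|` A|)%N.
  rewrite cardfsU !imfC // (_ : (_ `&` _)%fset = fset0) ?cardfs0 ?subn0 //.
  apply/fsetP=> y; rewrite in_fset0 in_fsetI; apply/negbTE/negP.
  case/andP=> /imfsetP[x /= _ yfx] /imfsetP[z /= _ ygz].
  have [_ _ fg px _] := gP x; have [_ _ _ _ pz] := gP z.
  have xz : x = z by apply: inc_inj; rewrite -px -pz -yfx -ygz.
  by subst z; apply: fg; rewrite -yfx -ygz.
have sub : (C A `<=` A `|` C (sigma A))%fset.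
  have step h x : edge x (h x) -> x \in A -> h x \notin A -> x \in sigma A.
    by move=> e xA hA; rewrite !inE xA /=; apply/asboolP; exists (h x).
  apply/fsubsetP=> y; rewrite !in_fsetU; have [//|yA /=] := boolP (y \in A).
  case/orP=> /imfsetP[x /= xA yE]; apply/orP; [left|right];
    apply/imfsetP; exists x => //=; have [ef eg _ _ _] := gP x.
    by apply: (step f _ ef xA); rewrite -yE.
  by apply: (step g _ eg xA); rewrite -yE.
have := fsubset_leq_card sub; rewrite CA.
move=> /leq_trans/(_ (leq_card_fsetU _ _).1).
have := (leq_card_fsetU [fset f x | x in sigma A]%fset
                        [fset g x | x in sigma A]%fset).1.
rewrite !imfC // -/(C (sigma A)); lia.
Qed.

(** A vertex is required because the infimum over the empty set is 0; together
with one of its children it provides a subgraph to which the bound applies. *)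
Lemma not_amenable_parent (R : realType) : inhabited X -> ~ amenable X R.
Proof.
case=> x; rewrite /amenable; set E := [set _ | _ in _] => infE.
suff : (2%:R^-1 : R) <= 0 by rewrite leNgt invr_gt0 ltr0n.
rewrite -infE; apply: lb_le_inf.
  have [y [_ [exy _ _ _ _]]] := two_children x.
  eexists; exists [fset x; y]%fset; last by [].
  split; last by exists x, y; rewrite !inE !eqxx orbT.
  move=> a b; rewrite !inE => /orP[]/eqP-> /orP[]/eqP->.
  - by exists [::].
  - by exists [:: y]; rewrite /= exy !inE eqxx orbT.
  - by exists [:: x]; rewrite /= edge_sym exy !inE eqxx.
  - by exists [::].
move=> _ [A [_ [a [_ [aA _ _]]]] <-].
have A0 : (0 < #|` A|)%N by rewrite cardfs_gt0; apply/fset0Pn; exists a.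
rewrite ler_pdivlMr ?ltr0n // ler_pdivrMl ?ltr0n // -natrM ler_nat.
exact: card_le_twice_sigma.
Qed.
End Parent.

(** * Fractional ideals of a discrete valuation ring *)

Section Valuation.
Variables (K : fieldType) (ord : K -> int) (pi : K).
Hypotheses (hK : is_local_field ord) (hpi : is_uniformizer ord pi).
Implicit Types (x y : K) (m k : int).

Local Notation ideal := (ideal_ord ord).

Lemma pi_neq0 : pi != 0. Proof. by apply/eqP; case: hpi. Qed.

Lemma piX_neq0 m : pi ^ m != 0. Proof. exact/expfz_neq0/pi_neq0. Qed.

Lemma ord_mul x y : x != 0 -> y != 0 -> ord (x * y) = ord x + ord y.
Proof. by move=> /eqP x0 /eqP y0; apply: (ordM hK). Qed.

Lemma ord_1 : ord 1 = 0.
Proof.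
by have := @ord_mul 1 1 (oner_neq0 K) (oner_neq0 K); rewrite mulr1; lia.
Qed.

Lemma ord_opp1 : ord (-1) = 0.
Proof.
have h : (-1 : K) != 0 by rewrite oppr_eq0 oner_neq0.
by have := ord_mul h h; rewrite mulrNN mulr1 ord_1; lia.
Qed.

Lemma ord_inv x : x != 0 -> ord x^-1 = - ord x.
Proof.
move=> x0; have := @ord_mul x x^-1 x0.
by rewrite invr_eq0 mulfV // ord_1 => /(_ x0); lia.
Qed.

Lemma ord_piX m : ord (pi ^ m) = m.
Proof.
have nat_case (n : nat) : ord (pi ^+ n) = n.
  elim: n => [|n IH]; first by rewrite expr0 ord_1.
  rewrite exprS ord_mul ?pi_neq0 ?expf_neq0 ?pi_neq0 // IH.
  by have [_ ->] := hpi; lia.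
case: m => n; first exact: nat_case.
by rewrite NegzE -exprnN ord_inv ?expf_neq0 ?pi_neq0 // nat_case.
Qed.

Lemma ideal0 m : ideal m 0. Proof. by left. Qed.

Lemma idealE m x : x != 0 -> ideal m x <-> m <= ord x.
Proof. by move=> /eqP x0; split=> [[/x0|]|]//; right. Qed.

Lemma idealD m x y : ideal m x -> ideal m y -> ideal m (x + y).
Proof.
move=> hx hy; have [-> | x0] := eqVneq x 0; first by rewrite add0r.
have [-> | y0] := eqVneq y 0; first by rewrite addr0.
have [-> | xy0] := eqVneq (x + y) 0; first exact: ideal0.
move: hx hy => /(idealE _ x0) hx /(idealE _ y0) hy; apply/idealE => //.
have := ordD hK (elimN eqP x0) (elimN eqP y0) (elimN eqP xy0).
by apply: le_trans; rewrite le_min hx hy.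
Qed.

Lemma idealM m k x y : ideal m x -> ideal k y -> ideal (m + k) (x * y).
Proof.
move=> hx hy; have [-> | x0] := eqVneq x 0.
  by rewrite mul0r; apply: ideal0.
have [-> | y0] := eqVneq y 0.
  by rewrite mulr0; apply: ideal0.
move: hx hy => /(idealE _ x0) hx /(idealE _ y0) hy.
by apply/idealE; rewrite ?mulf_neq0 // ord_mul // lerD.
Qed.

Lemma ideal_ord_self x : ideal (ord x) x. Proof. by right. Qed.

Lemma ideal_ordM m x y : x != 0 -> ideal m (x * y) <-> ideal (m - ord x) y.
Proof.
move=> x0; split=> h.
  have := idealM (ideal_ord_self x^-1) h.
  by rewrite mulKf // ord_inv // addrC.
by have := idealM (ideal_ord_self x) h; rewrite addrC subrK.
Qed.

Lemma ideal_piM m k x : ideal m (pi ^ k * x) <-> ideal (m - k) x.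
Proof. by rewrite ideal_ordM ?piX_neq0 // ord_piX. Qed.

Lemma idealN m x : ideal m (- x) <-> ideal m x.
Proof.
by rewrite -mulN1r ideal_ordM ?oppr_eq0 ?oner_neq0 // ord_opp1 subr0.
Qed.

Lemma ideal_le m k x : k <= m -> ideal m x -> ideal k x.
Proof. by move=> km [->|h]; [left | right; apply: le_trans h]. Qed.

Lemma ideal_sum m (I : finType) (f : I -> K) :
  (forall i, ideal m (f i)) -> ideal m (\sum_i f i).
Proof.
move=> h; apply: (big_ind (ideal m)) => //; first exact: ideal0.
exact: idealD.
Qed.

(** Finitely many scalars are brought into pi^m O by the same powers of pi. *)
Lemma ideal_absorb m (I : finType) (f : I -> K) :
  exists N : int, forall i k, N <= k -> ideal m (pi ^ k * f i).
Proof.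
exists (\sum_i `|m - ord (f i)|) => i k; rewrite (bigD1 i) //= => h.
apply/ideal_piM; right; set S := \sum_(_ | _) _ in h.
have : 0 <= S by apply: sumr_ge0.
by have := ler_norm (m - ord (f i)); lia.
Qed.

End Valuation.

(** * Symplectic linear algebra *)

Section Symplectic.
Variables (K : fieldType) (V : vectType K) (B : {biscalar V}).
Hypothesis alt : alternating B.
Implicit Types (x y z : V) (U : {vspace V}).

Lemma formDl x y z : B (x + y) z = B x z + B y z. Proof. exact: linearDl. Qed.
Lemma formDr x y z : B x (y + z) = B x y + B x z. Proof. exact: linearDr. Qed.
Lemma formZl a x y : B (a *: x) y = a * B x y. Proof. exact: linearZl_LR. Qed.
Lemma formZr a x y : B x (a *: y) = a * B x y. Proof. exact: linearZr_LR. Qed.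
Lemma formNl x y : B (- x) y = - B x y. Proof. exact: linearNl. Qed.
Lemma form0l x : B 0 x = 0. Proof. exact: linear0l. Qed.
Lemma form_suml (I : finType) (F : I -> V) x :
  B (\sum_i F i) x = \sum_i B (F i) x.
Proof. exact: linear_sumlz. Qed.
Lemma form_sumr (I : finType) (F : I -> V) x :
  B x (\sum_i F i) = \sum_i B x (F i).
Proof. exact: linear_sumr. Qed.

Lemma formC x y : B x y = - B y x.
Proof.
have := alt (x + y); rewrite formDl !formDr !alt add0r addr0.
by move=> /addr0_eq <-; rewrite opprK.
Qed.

(** A linear map whose kernel is the orthogonal of the family w. *)
Definition orth_map k (w : 'I_k -> V) x : 'rV[K]_k := \row_j B x (w j).

Lemma orth_map_linear k (w : 'I_k -> V) : linear (orth_map w).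
Proof. by move=> a x y; apply/rowP=> j; rewrite !mxE formDl formZl. Qed.

HB.instance Definition _ k (w : 'I_k -> V) :=
  GRing.isLinear.Build K V 'rV[K]_k _ (orth_map w) (orth_map_linear w).

Lemma exists_orth U k (w : 'I_k -> V) : (k < \dim U)%N ->
  exists x, [/\ x \in U, x != 0 & forall j, B x (w j) = 0].
Proof.
move=> kU; pose f := linfun (orth_map w).
have : (U :&: lker f)%VS != 0%VS.
  rewrite -dimv_eq0; have := limg_ker_dim f U.
  have := dimvS (subvf (f @: U)%VS); rewrite dimvf /dim /= mul1n; lia.
rewrite -vpick0 => x0; exists (vpick (U :&: lker f)%VS).
have := memv_pick (U :&: lker f)%VS; rewrite memv_cap => /andP[-> xf].
split=> // j; move: xf; rewrite memv_ker lfunE /= => /eqP/rowP/(_ j).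
by rewrite !mxE.
Qed.

Definition isotropic U := forall x y, x \in U -> y \in U -> B x y = 0.

(** As long as dim U < n, a complement of U has a greater dimension than U, so
it contains a nonzero vector orthogonal to U; adding this vector to U keeps it
isotropic because the form is alternating. *)
Lemma exists_isotropic n : (2 * n <= \dim {:V})%N ->
  exists2 U, isotropic U & \dim U = n.
Proof.
elim: n => [|n IH] le_n.
  exists 0%VS; last by rewrite dimv0.
  by move=> x y; rewrite memv0 => /eqP-> _; rewrite form0l.
have [|U isoU dimU] := IH; first lia.
have [|x [xC x0 xU]] :=
  @exists_orth (U^C)%VS _ (fun i : 'I_(\dim U) => (vbasis U)`_i).
  rewrite dimv_compl; lia.
have orth y : y \in U -> B x y = 0.
  move=> yU; rewrite (coord_vbasis yU) form_sumr big1 // => i _.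
  by rewrite formZr xU mulr0.
exists (U + <[x]>)%VS.
  move=> y' z' /memv_addP[y yU [_ /vlineP[a ->] ->]].
  move=> /memv_addP[z zU [_ /vlineP[b ->] ->]].
  rewrite !formDl !formDr !formZl !formZr alt isoU // (orth z) //.
  by rewrite (formC y x) orth // oppr0 !mulr0 !addr0.
rewrite dimv_disjoint_sum ?dim_vline ?x0 ?dimU ?addn1 //.
apply/eqP; rewrite -subv0; apply/subvP=> y; rewrite memv_cap => /andP[yU].
case/vlineP=> a ya; rewrite memv0; apply/eqP.
have : y \in (U :&: U^C)%VS by rewrite memv_cap yU ya memvZ.
by rewrite capv_compl memv0 => /eqP.
Qed.

(** A partial symplectic basis, up to the scale c: the form is c times the
standard one. *)
Definition symplectic_family (c : K) k (u w : 'I_k -> V) : Prop :=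
  [/\ forall i j, B (u i) (w j) = c * (i == j)%:R,
      forall i j, B (u i) (u j) = 0 &
      forall i j, B (w i) (w j) = 0].

(** Coordinates in a symplectic family are read off by pairing with the dual
vectors. *)
Lemma form_family c k (u w : 'I_k -> V) (a b : 'I_k -> K) i :
  symplectic_family c u w ->
  B (\sum_i a i *: u i + \sum_i b i *: w i) (u i) = - (c * b i) /\
  B (\sum_i a i *: u i + \sum_i b i *: w i) (w i) = c * a i.
Proof.
case=> uw uu ww; rewrite !formDl !form_suml.
have -> : \sum_j B (a j *: u j) (u i) = 0.
  by rewrite big1 // => j _; rewrite formZl uu mulr0.
have -> : \sum_j B (b j *: w j) (w i) = 0.
  by rewrite big1 // => j _; rewrite formZl ww mulr0.
have -> : \sum_j B (b j *: w j) (u i) = - (c * b i).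
  rewrite (bigD1 i) //= big1 => [|j ji]; rewrite formZl formC uw.
    by rewrite eqxx mulr1; ring.
  by rewrite eq_sym (negbTE ji) !(mulr0, oppr0).
have -> : \sum_j B (a j *: u j) (w i) = c * a i.
  rewrite (bigD1 i) //= big1 => [|j ji]; rewrite formZl uw.
    by rewrite eqxx mulr1; ring.
  by rewrite (negbTE ji) !mulr0.
by rewrite add0r addr0.
Qed.

Lemma family_free c k (u w : 'I_k -> V) (a b : 'I_k -> K) : c != 0 ->
  symplectic_family c u w ->
  \sum_i a i *: u i + \sum_i b i *: w i = 0 ->
  forall i, a i = 0 /\ b i = 0.
Proof.
move=> c0 fam sum0 i; have [] := form_family a b i fam.
rewrite sum0 !form0l => /esym/eqP hb /esym/eqP ha; move: ha hb.
by rewrite oppr_eq0 !mulf_eq0 (negbTE c0) /= => /eqP-> /eqP->.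
Qed.

Lemma family_basis c n (u w : n.-tuple V) : c != 0 ->
  \dim {:V} = (2 * n)%N -> symplectic_family c (tnth u) (tnth w) ->
  basis_of {:V} (u ++ w).
Proof.
move=> c0 dimV fam; rewrite basisEfree subvf size_cat !size_tuple dimV.
rewrite mul2n addnn leqnn !andbT.
suff : free [tuple of u ++ w] by [].
apply/freeP => a.
rewrite (eq_bigr (fun i => a i *: tnth [tuple of u ++ w] i)); last first.
  by move=> i _; rewrite (tnth_nth 0).
rewrite big_split_ord /=.
under eq_bigr do rewrite tnth_lshift.
under [X in _ + X]eq_bigr do rewrite tnth_rshift.
move=> /(family_free (a := a \o @lshift n n) (b := a \o @rshift n n)
          c0 fam) h i.
by case: (split_ordP i) => j ->; have [] := h j.
Qed.

Hypothesis nondeg : nondegenerate_form B.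

(** The difference of the two sides is orthogonal to the whole basis. *)
Lemma family_expansion c n (u w : 'I_n -> V) x : c != 0 ->
  \dim {:V} = (2 * n)%N -> symplectic_family c u w ->
  x = \sum_i (c^-1 * B x (w i)) *: u i + \sum_i (- (c^-1 * B x (u i))) *: w i.
Proof.
move=> c0 dimV fam; set y := RHS; apply/eqP; rewrite -subr_eq0; apply/eqP.
apply: nondeg => z; set d := x - y.
have du i : B d (u i) = 0.
  have [h _] := form_family (fun i => c^-1 * B x (w i))
                  (fun i => - (c^-1 * B x (u i))) i fam.
  by rewrite formDl formNl h mulrN opprK mulVKf // subrr.
have dw i : B d (w i) = 0.
  have [_ h] := form_family (fun i => c^-1 * B x (w i))
                  (fun i => - (c^-1 * B x (u i))) i fam.
  by rewrite formDl formNl h mulVKf // subrr.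
have fam' : symplectic_family c (tnth (mktuple u)) (tnth (mktuple w)).
  by case: fam => *; split=> i j; rewrite !tnth_mktuple.
have bas := family_basis c0 dimV fam'.
have : z \in <<[tuple of mktuple u ++ mktuple w]>>%VS.
  by rewrite (span_basis bas) memvf.
move/coord_span->; rewrite form_sumr big1 // => i _; rewrite formZr.
rewrite -(tnth_nth 0); case: (split_ordP i) => j ->.
  by rewrite tnth_lshift tnth_mktuple du mulr0.
by rewrite tnth_rshift tnth_mktuple dw mulr0.
Qed.

Definition extend k (u : 'I_k -> V) x (i : 'I_k.+1) : V :=
  if unlift ord_max i is Some j then u j else x.

Lemma extend_max k (u : 'I_k -> V) x : extend u x ord_max = x.
Proof. by rewrite /extend unlift_none. Qed.

Lemma extend_lift k (u : 'I_k -> V) x j : extend u x (lift ord_max j) = u j.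
Proof. by rewrite /extend liftK. Qed.

(** Greedy construction of hyperbolic pairs inside L, with first vectors in U.
While k < dim U, some nonzero vector of U is orthogonal to w_1, ..., w_k; it is
orthogonal to u_1, ..., u_k since U is isotropic. A partner y of a multiple of
it is made orthogonal to the pairs at hand by subtracting its components along
them, and the hypothesis on c^-1 B x y keeps the corrected partner in L. With
L = V this yields symplectic bases, and with L a lattice it yields the Iwasawa
decomposition. *)
Lemma exists_family (c : K) (L : set V) U :
    c != 0 -> isotropic U ->
    L 0 -> (forall x y, L x -> L y -> L (x + y)) ->
    (forall x y z, L x -> L y -> L z -> L ((c^-1 * B x y) *: z)) ->
    (forall x, x \in U -> x != 0 ->
       exists a y, [/\ L (a *: x), L y & B (a *: x) y = c]) ->
  forall k, (k <= \dim U)%N -> exists u w : 'I_k -> V,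
    symplectic_family c u w /\ forall i, [/\ u i \in U, L (u i) & L (w i)].
Proof.
move=> c0 isoU L0 LD LZ pair; elim=> [|k IH] kU.
  by exists (fun=> 0), (fun=> 0); split; [split|]; case.
have [|u [w [[uw uu ww] h]]] := IH; first exact: ltnW.
have [x0 [x0U x0n x0w]] := exists_orth w kU.
have [a [y [Lx Ly xy]]] := pair x0 x0U x0n.
set x := a *: x0 in Lx xy.
have xU : x \in U by apply: memvZ.
have xw j : B x (w j) = 0 by rewrite formZl x0w mulr0.
have ux j : B (u j) x = 0 by apply: isoU => //; have [] := h j.
pose z := \sum_j (c^-1 * B (w j) y) *: u j + \sum_j (c^-1 * B y (u j)) *: w j.
have fam : symplectic_family c u w by [].
have Lsum (v : 'I_k -> V) : (forall j, L (v j)) -> L (\sum_j v j).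
  by move=> Lv; apply: (big_ind L).
have Lz : L z.
  by apply: LD; apply: Lsum => j; have [_ Lu Lw] := h j; apply: LZ.
have zu j : B z (u j) = - B y (u j).
  by rewrite /z; have [-> _] := form_family (fun i => c^-1 * B (w i) y)
    (fun i => c^-1 * B y (u i)) j fam; rewrite mulVKf.
have zw j : B z (w j) = B (w j) y.
  by rewrite /z; have [_ ->] := form_family (fun i => c^-1 * B (w i) y)
    (fun i => c^-1 * B y (u i)) j fam; rewrite mulVKf.
have xz : B x z = 0.
  rewrite formDr !form_sumr !big1 ?addr0 // => j _; rewrite formZr.
    by rewrite xw mulr0.
  by rewrite (formC x) ux oppr0 mulr0.
have uy' j : B (u j) (y + z) = 0.
  by rewrite formDr (formC _ z) zu (formC y) opprK addrN.
have wy' j : B (w j) (y + z) = 0 by rewrite formDr (formC _ z) zw addrN.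
exists (extend u x), (extend w (y + z)); split; last first.
  move=> i; case: (unliftP ord_max i) => [j|] ->;
    rewrite ?extend_lift ?extend_max.
    exact: h.
  by split=> //; apply: LD.
split=> i j; case: (unliftP ord_max i) => [i'|] ->;
  case: (unliftP ord_max j) => [j'|] ->; rewrite ?extend_lift ?extend_max //.
- by rewrite uw (inj_eq (@lift_inj _ _)).
- by rewrite uy' eq_sym (negbTE (neq_lift _ _)) mulr0.
- by rewrite xw (negbTE (neq_lift _ _)) mulr0.
- by rewrite formDr xy xz addr0 eqxx mulr1.
- by rewrite formC ux oppr0.
- by rewrite formC wy' oppr0.
Qed.

Lemma exists_symplectic_family n U : isotropic U -> \dim U = n ->
  exists u w : 'I_n -> V, symplectic_family 1 u w.
Proof.
move=> isoU dimU.
have [] := @exists_family 1 setT U (oner_neq0 _) isoU I _ _ _ n;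
  rewrite ?dimU //.
  move=> x _ x0; have [y xy] : exists y, B x y != 0.
    apply: contrapT => h; move/eqP: x0; apply; apply: nondeg => y.
    by apply/eqP; apply/negPn/negP => xy; apply: h; exists y.
  by exists 1, ((B x y)^-1 *: y); split=> //; rewrite scale1r formZr mulVf.
by move=> u [w [fam _]]; exists u, w.
Qed.
End Symplectic.

(** * Lattices self-dual up to scale *)

Section Lattices.
Variables (K : fieldType) (ord : K -> int) (pi : K).
Variables (V : vectType K) (B : {biscalar V}) (n : nat).
Hypotheses (hK : is_local_field ord) (hpi : is_uniformizer ord pi).
Hypotheses (dimV : \dim {:V} = (2 * n)%N) (n_gt0 : (0 < n)%N).
Hypotheses (alt : alternating B) (nondeg : nondegenerate_form B).
Implicit Types (L M : set V) (s : int) (x y : V) (u w : 'I_n -> V).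

Local Notation ideal := (ideal_ord ord).
Local Notation family s u w := (symplectic_family B (pi ^ s) u w).

Lemma exists_lagrangian : exists2 U : {vspace V}, isotropic B U & \dim U = n.
Proof. by apply: exists_isotropic; rewrite ?dimV. Qed.

(** The first clause makes L span V; together with the second one it makes L a
lattice ([self_dual_lattice]). *)
Record self_dual s L : Prop := SelfDual {
  self_dual_absorb : forall x, exists k : int, L (pi ^ k *: x);
  self_dualP : forall x, L x <-> forall y, L y -> ideal s (B x y) }.

Lemma self_dual0 s L : self_dual s L -> L 0.
Proof. by case=> _ h; apply/h => y _; rewrite form0l; apply: ideal0. Qed.

Lemma self_dualD s L x y : self_dual s L -> L x -> L y -> L (x + y).
Proof.
case=> _ h /h hx /h hy; apply/h => z Lz; rewrite formDl.
by apply: idealD; [| apply: hx | apply: hy].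
Qed.

Lemma self_dualZ s L a x : self_dual s L -> ideal 0 a -> L x -> L (a *: x).
Proof.
case=> _ h ha /h hx; apply/h => z Lz; rewrite formZl -[s]add0r.
by apply: (idealM hK) => //; apply: hx.
Qed.

Lemma self_dual_form s L x y : self_dual s L -> L x -> L y -> ideal s (B x y).
Proof. by case=> _ h /h; apply. Qed.

Lemma coefE s a : ideal s a -> ideal 0 ((pi ^ s)^-1 * a).
Proof.
move=> ha; rewrite invr_expz; apply/(ideal_piM hK hpi).
by rewrite sub0r opprK.
Qed.

Lemma self_dual_coef s L x y z : self_dual s L -> L x -> L y -> L z ->
  L (((pi ^ s)^-1 * B x y) *: z).
Proof.
move=> sd Lx Ly; apply: (self_dualZ sd).
by apply: coefE; apply: self_dual_form Lx Ly.
Qed.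

(** Scale x to be primitive in L: take the least m with pi^m x in L. Then
pi^(m-1) x is not in the dual of L, so some z in L has <pi^m x, z> of valuation
exactly s, and a unit multiple of z has the required pairing. *)
Lemma self_dual_pair s L x : self_dual s L -> x != 0 ->
  exists a y, [/\ L (a *: x), L y & B (a *: x) y = pi ^ s].
Proof.
move=> sd x0; have [m Lm] := self_dual_absorb sd x.
have [y xy] : exists y, B x y != 0.
  apply: contrapT => h; move/eqP: x0; apply; apply: nondeg => y.
  by apply/eqP; apply/negPn/negP => xy; apply: h; exists y.
have [k Lk] := self_dual_absorb sd y.
(* A lower bound for the exponents j with pi^j x in L, which makes the
   minimum available over the natural numbers. *)
have low j : L (pi ^ j *: x) -> s - k - ord (B x y) <= j.
  move=> Lj; have := self_dual_form sd Lj Lk; rewrite formZl formZr.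
  by rewrite !(ideal_piM hK hpi) => /(idealE _ _ xy); lia.
pose P (i : nat) := `[< L (pi ^ (s - k - ord (B x y) + i%:Z) *: x) >].
have exP : exists i, P i.
  exists (absz (m - (s - k - ord (B x y)))%R); apply/asboolP.
  by have := low _ Lm => le_m; rewrite gez0_abs ?subr_ge0 // addrC subrK.
have [i /asboolP Pi min_i] := ex_minnP exP.
set j := _ + i%:Z in Pi.
have nL : ~ L (pi ^ (j - 1) *: x).
  move=> Lj; have := low _ Lj; rewrite /j => le_i.
  have : P i.-1.
    apply/asboolP; congr (L (pi ^ _ *: x)): Lj; rewrite /j; lia.
  move=> /min_i; lia.
have [z [Lz xz]] : exists z, L z /\ ~ ideal s (pi ^ (j - 1) * B x z).
  apply: contrapT => h; apply: nL; apply/(self_dualP sd) => z Lz.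
  by rewrite formZl; apply: contrapT => xz; apply: h; exists z.
have xz0 : B x z != 0.
  by apply/eqP => xz0; apply: xz; rewrite xz0 mulr0; apply: ideal0.
have ord_xz : ord (B x z) = s - j.
  move/(ideal_piM hK hpi)/(idealE ord _ xz0): xz => xz.
  have := self_dual_form sd Pi Lz; rewrite formZl => /(ideal_piM hK hpi).
  by move=> /(idealE ord _ xz0); lia.
exists (pi ^ j), ((pi ^ (s - j) / B x z) *: z); split=> //.
  apply: (self_dualZ sd) => //; apply/(ideal_piM hK hpi); right.
  by rewrite (ord_inv hK) // ord_xz; lia.
rewrite formZl formZr mulfVK // -expfzDr ?(pi_neq0 hpi) //.
by rewrite addrC subrK.
Qed.

(** The O-span of a symplectic family, described by pairings rather than by
coefficients ([family_latticeP] compares the two). *)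
Definition family_lattice s u w : set V :=
  [set x | forall i, ideal s (B x (u i)) /\ ideal s (B x (w i))].

Lemma family_lattice_mem s u w : family s u w ->
  forall i, family_lattice s u w (u i) /\ family_lattice s u w (w i).
Proof.
case=> uw uu ww i.
have delta j k : ideal s (pi ^ s * (j == k :> 'I_n)%:R).
  apply/(ideal_piM hK hpi); rewrite subrr; case: eqP => _; last exact: ideal0.
  by right; rewrite (ord_1 hK).
split=> j; rewrite ?uu ?ww ?uw.
  by split; [exact: ideal0 | exact: delta].
split; last exact: ideal0.
by rewrite (formC alt) uw; apply/(idealN hK).
Qed.

Lemma family_latticeP s u w : family s u w -> family_lattice s u w =
  [set x + y | x in O_span ord u & y in O_span ord w].
Proof.
move=> fam; have fam' := fam; case: fam' => uw uu ww.
have s0 : pi ^ s != 0 by apply: piX_neq0 hpi _.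
apply/seteqP; split=> [x Lx | _ [_ [a a0 ->] [_ [b b0 ->] <-]] i].
  rewrite (family_expansion alt nondeg x s0 dimV fam).
  eexists; [eexists; [|by []] | eexists; [eexists; [|by []]|by []]].
    by move=> i; apply: coefE; case: (Lx i).
  by move=> i; apply/(idealN hK)/coefE; case: (Lx i).
have [-> ->] := form_family alt a b i fam.
split; [apply/(idealN hK)|]; apply/(ideal_piM hK hpi); rewrite subrr.
  exact: b0.
exact: a0.
Qed.

Lemma family_lattice_self_dual s u w : family s u w ->
  self_dual s (family_lattice s u w).
Proof.
move=> fam; split=> [x|x].
  have [N1 h1] := ideal_absorb hK hpi s (fun i => B x (u i)).
  have [N2 h2] := ideal_absorb hK hpi s (fun i => B x (w i)).
  exists (Num.max N1 N2) => i; rewrite !formZl.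
  by split; [apply: h1 | apply: h2]; rewrite le_max lexx ?orbT.
split=> [Lx y Ly | h i]; last first.
  by have [Lu Lw] := family_lattice_mem fam i; split; apply: h.
move: Ly; rewrite (family_latticeP fam) => -[_ [a a0 ->] [_ [b b0 ->] <-]].
rewrite formDr !form_sumr; apply: (idealD hK); apply: (ideal_sum hK) => i;
  rewrite formZr -[s]add0r; apply: (idealM hK); rewrite ?add0r.
- exact: a0.
- by have [] := Lx i.
- exact: b0.
- by have [] := Lx i.
Qed.

(** Duality reverses inclusions. *)
Lemma self_dual_incl s L M : self_dual s L -> self_dual s M ->
  L `<=` M -> L = M.
Proof.
move=> sdL sdM LM; apply/seteqP; split=> // x Mx.
by apply/(self_dualP sdL) => y Ly; apply: self_dual_form Mx (LM _ Ly).
Qed.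

(** In terms of groups: the similitude group is the product of the parabolic
subgroup that stabilizes U and of the stabilizer of L. *)
Lemma Iwasawa s L (U : {vspace V}) : isotropic B U -> \dim U = n ->
  self_dual s L -> exists u w,
  [/\ family s u w, forall i, u i \in U & L = family_lattice s u w].
Proof.
move=> isoU dimU sd.
have [] := @exists_family _ _ B alt (pi ^ s) L U (piX_neq0 hpi s) isoU
             (self_dual0 sd) _ _ _ n; rewrite ?dimU //.
- by move=> x y; apply: (self_dualD sd).
- by move=> x y z; apply: (self_dual_coef sd).
- by move=> x _; apply: (self_dual_pair sd).
move=> u [w [fam h]]; exists u, w; split=> // [i|]; first by have [] := h i.
apply: (self_dual_incl sd (family_lattice_self_dual fam)) => x Lx i.
by have [_ Lu Lw] := h i; split; apply: (self_dual_form sd).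
Qed.

Lemma self_dual_lattice s L : self_dual s L -> is_lattice ord L.
Proof.
move=> sd; have [U isoU dimU] := exists_lagrangian.
have [u [w [fam _ ->]]] := Iwasawa isoU dimU sd.
rewrite (family_latticeP fam) /is_lattice dimV.
have -> : (2 * n = n + n)%N by lia.
pose e (i : 'I_(n + n)) :=
  match fintype.split i with inl j => u j | inr j => w j end.
have eE (c : 'I_(n + n) -> K) : \sum_i c i *: e i =
    \sum_i c (lshift n i) *: u i + \sum_i c (rshift n i) *: w i.
  rewrite big_split_ord /=; congr (_ + _); apply: eq_bigr => i _.
    by rewrite /e (unsplitK (inl i)).
  by rewrite /e (unsplitK (inr i)).
exists e.
  move=> c _; rewrite eE.
  move=> /(family_free alt (a := c \o @lshift n n) (b := c \o @rshift n n)
            (piX_neq0 hpi s) fam) h i.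
  by case: (split_ordP i) => j ->; have [] := h j.
apply/seteqP; split=> [_ [_ [a a0 ->] [_ [b b0 ->] <-]] | _ [c c0 ->]].
  exists (fun i => match fintype.split i with inl j => a j | inr j => b j end).
    by move=> i; case: fintype.split.
  rewrite eE; congr (_ + _); apply: eq_bigr => i _.
    by rewrite (unsplitK (inl i)).
  by rewrite (unsplitK (inr i)).
rewrite eE; eexists; [eexists; [|by []] | eexists; [eexists; [|by []]|by []]].
  by move=> i; apply: c0.
by move=> i; apply: c0.
Qed.

(** * Homotheties *)

Lemma scale_setE a L x : a != 0 -> scale_set a L x <-> L (a^-1 *: x).
Proof.
move=> a0; split=> [[y Ly <-]|Lx]; first by rewrite scalerA mulVf ?scale1r.
by exists (a^-1 *: x); rewrite ?scalerA ?mulfV ?scale1r.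
Qed.

Lemma scale_setM a b L : scale_set a (scale_set b L) = scale_set (a * b) L.
Proof.
rewrite /scale_set image_comp; congr image; apply/funext => x /=.
by rewrite scalerA.
Qed.

Lemma scale_set1 L : scale_set 1 L = L.
Proof.
by rewrite -[RHS]image_id; congr image; apply/funext => x; rewrite scale1r.
Qed.

Lemma scale_subset a L M : L `<=` M -> scale_set a L `<=` scale_set a M.
Proof. by move=> LM; apply: image_subset. Qed.

Lemma homothety_refl L : homothety_class L L.
Proof. by exists 1; [exact/eqP/oner_neq0 | rewrite scale_set1]. Qed.

Lemma homothety_classE L M : homothety_class L M ->
  homothety_class M = homothety_class L.
Proof.
case=> a /eqP a0 ->; apply/seteqP; split=> _ [b /eqP b0 ->].
  by exists (b * a); [apply/eqP/mulf_neq0 | rewrite scale_setM].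
exists (b / a); first by apply/eqP; rewrite mulf_neq0 ?invr_eq0.
by rewrite scale_setM mulfVK.
Qed.

Lemma homothety_scale a L : a != 0 ->
  homothety_class (scale_set a L) = homothety_class L.
Proof. by move=> /eqP a0; apply: homothety_classE; exists a. Qed.

(** Homotheties change the scale by an even integer, so its parity is an
invariant of the class: this is the type of the vertex. *)
Lemma self_dual_scale s L a : a != 0 -> self_dual s L ->
  self_dual (s + ord a *+ 2) (scale_set a L).
Proof.
move=> a0 sd; split=> [x|x].
  have [k Lk] := self_dual_absorb sd (a^-1 *: x); exists k.
  by apply/scale_setE; rewrite // scalerA mulrC -scalerA.
rewrite scale_setE // (self_dualP sd); split=> [h _ [y Ly <-] | h y Ly].
  have := h _ Ly; rewrite formZl formZr !(ideal_ordM hK) ?invr_eq0 //.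
  by rewrite (ord_inv hK) // (_ : s + _ - _ = s - - ord a) // mulr2n; ring.
have := h (a *: y); rewrite formZl formZr !(ideal_ordM hK) ?invr_eq0 //.
rewrite (ord_inv hK) // (_ : s + _ - _ = s - - ord a).
  by apply; exists y.
by rewrite mulr2n; ring.
Qed.

Lemma self_dual_piX s L k : self_dual s L ->
  self_dual (s + k *+ 2) (scale_set (pi ^ k) L).
Proof.
move=> sd; have := self_dual_scale (piX_neq0 hpi k) sd.
by rewrite (ord_piX hK hpi).
Qed.

(** The form takes a value of valuation exactly s on a hyperbolic pair of L. *)
Lemma self_dual_uniq s s' L : self_dual s L -> self_dual s' L -> s = s'.
Proof.
suff le r r' : self_dual r L -> self_dual r' L -> r' <= r.
  by move=> h h'; apply/eqP; rewrite eq_le !le.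
move=> sd sd'; have [U isoU dimU] := exists_lagrangian.
have [u [w [fam _ LE]]] := Iwasawa isoU dimU sd.
pose i0 := Ordinal n_gt0; have [Lu Lw] := family_lattice_mem fam i0.
rewrite -LE in Lu Lw; have := self_dual_form sd' Lu Lw; case: fam => -> _ _.
rewrite eqxx mulr1 => /(idealE ord _ (piX_neq0 hpi r)).
by rewrite (ord_piX hK hpi).
Qed.

Lemma self_dual_sum s L (I : finType) (a : I -> K) (v : I -> V) :
  self_dual s L -> (forall i, ideal 0 (a i)) -> (forall i, L (v i)) ->
  L (\sum_i a i *: v i).
Proof.
move=> sd ha hv; apply: (big_ind L) => [||i _]; first exact: self_dual0 sd.
  by move=> x y; apply: (self_dualD sd).
by apply: (self_dualZ sd).
Qed.

(** * Parents and children *)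

(** The representative of the parent of [L] singled out by L itself. It commutes
with homotheties, hence defines a map on classes. *)
Definition parent_lattice (U : {vspace V}) L : set V :=
  [set pi *: x + y | x in L & y in L `&` [set y | y \in U]].

Lemma parent_lattice_scale U a L : a != 0 ->
  parent_lattice U (scale_set a L) = scale_set a (parent_lattice U L).
Proof.
move=> a0; apply/seteqP; split.
  move=> _ [_ [x Lx <-] [_ [[y Ly <-] /= yU] <-]].
  exists (pi *: x + y); last by rewrite scalerDr !scalerA mulrC.
  exists x => //; exists y => //; split=> //=.
  by rewrite -[y](scalerK a0) memvZ.
move=> _ [_ [x Lx [y [Ly /= yU] <-]] <-].
exists (a *: x); first by exists x.
exists (a *: y); first by split; [exists y | apply: memvZ].
by rewrite scalerDr !scalerA mulrC.
Qed.

(** C is a neighbour of L whose image in L / pi L is a complement of the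
reduction of L :&: U; the last clause expresses this property. *)
Definition is_child (U : {vspace V}) s L C :=
  [/\ self_dual (s + 1) C, scale_set pi L `<=` C, C `<=` L &
      parent_lattice U C = scale_set pi L].

Lemma ideal_pi s a : ideal (s + 1) (pi * a) <-> ideal s a.
Proof. by rewrite -(expr1z pi) (ideal_piM hK hpi) addrK. Qed.

(** The lattice spanned by the pi u_i and the w_i reduces to the span of the
w_i in L / pi L, a Lagrangian complement of the span of the u_i, which is the
reduction of L :&: U. *)
Lemma family_child (U : {vspace V}) s u w : isotropic B U ->
    family s u w -> (forall i, u i \in U) ->
  is_child U s (family_lattice s u w)
    (family_lattice (s + 1) (fun i => pi *: u i) w).
Proof.
move=> isoU fam uU.
set L := family_lattice s u w; set C := family_lattice _ _ _.
have famC : family (s + 1) (fun i => pi *: u i) w.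
  case: fam => uw uu ww; split=> // i j; rewrite formZl ?formZr.
    by rewrite uw expfzDr ?(pi_neq0 hpi) // expr1z mulrA (mulrC pi).
  by rewrite uu !mulr0.
have sdL := family_lattice_self_dual fam.
have sdC := family_lattice_self_dual famC.
have piL_C : scale_set pi L `<=` C.
  move=> _ [x Lx <-] i; have [hu hw] := Lx i; rewrite formZr !formZl.
  by split; rewrite ideal_pi //; apply: (ideal_le (m := s + 1));
    rewrite ?ideal_pi ?lerDl.
have CL : C `<=` L.
  move=> x Cx i; have [] := Cx i; rewrite formZr ideal_pi => hu hw; split=> //.
  by apply: ideal_le hw; rewrite lerDl.
split=> //; apply/seteqP; split.
  move=> _ [x Cx [y [Cy /= yU] <-]]; apply/scale_setE; first exact: pi_neq0 hpi.
  rewrite scalerDr scalerA mulVf ?(pi_neq0 hpi) // scale1r.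
  apply: (self_dualD sdL); first exact: CL.
  move=> i; have [_ hw] := Cy i; rewrite !formZl isoU // mulr0.
  split; first exact: ideal0.
  by rewrite -ideal_pi mulVKf ?(pi_neq0 hpi).
move=> _ [x Lx <-]; rewrite /L (family_latticeP fam) in Lx.
case: Lx => [_ [a a0 ->] [_ [b b0 ->] <-]]; rewrite scalerDr addrC.
have Cuw := family_lattice_mem famC.
exists (\sum_i b i *: w i).
  by apply: (self_dual_sum sdC) => // i; have [] := Cuw i.
have -> : pi *: (\sum_i a i *: u i) = \sum_i a i *: (pi *: u i).
  by rewrite scaler_sumr; apply: eq_bigr => i _; rewrite !scalerA mulrC.
eexists; last by [].
split; first by apply: (self_dual_sum sdC) => // i; have [] := Cuw i.
by apply: memv_suml => i _; rewrite !memvZ.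
Qed.

(** Replacing w_0 with w_0 + u_0 gives another adapted basis of L, hence a child
D next to the child C of the original basis. They have the same scale, so a
homothety between them would be by a unit, and C would equal D; but w_0 lies in
C and its pairing with w_0 + u_0 has valuation s, too small for D. *)
Lemma two_child_lattices (U : {vspace V}) s L : isotropic B U -> \dim U = n ->
  self_dual s L -> exists C D,
  [/\ is_child U s L C, is_child U s L D & ~ homothety_class C D].
Proof.
move=> isoU dimU sd; have [u [w [fam uU LE]]] := Iwasawa isoU dimU sd.
pose i0 := Ordinal n_gt0.
pose w' i := w i + (i == i0)%:R *: u i.
have fam' : family s u w'.
  case: fam => uw uu ww; split=> // i j;
    rewrite /w' !(formDl, formDr, formZl, formZr).
    by rewrite uw uu mulr0 addr0.
  rewrite ww uu (formC alt (w i)) !uw.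
  by have [->|ij] := eqVneq i j;
    rewrite ?eqxx ?(eq_sym j i) ?(negbTE ij) ?mulr0n; ring.
have LE' : L = family_lattice s u w'.
  rewrite LE; apply: (self_dual_incl (family_lattice_self_dual fam)).
    exact: family_lattice_self_dual.
  move=> x Lx i; have [hu hw] := Lx i; split=> //.
  rewrite formDr formZr; apply: (idealD hK) => //.
  by case: eqP; rewrite ?mul1r ?mul0r // => _; apply: ideal0.
have chC := family_child isoU fam uU; have chD := family_child isoU fam' uU.
rewrite -LE in chC; rewrite -LE' in chD.
set C := family_lattice _ _ _ in chC; set D := family_lattice _ _ _ in chD.
exists C, D; split=> // -[a /eqP a0 DE].
have [sdC _ _ _] := chC; have [sdD _ _ _] := chD.
have orda : ord a = 0.
  have := self_dual_scale a0 sdC; rewrite -DE => /(self_dual_uniq sdD).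
  by rewrite mulr2n; lia.
have Cw : C (w i0).
  case: fam => uw _ ww i; rewrite ww formZr (formC alt) uw.
  split; last exact: ideal0.
  rewrite ideal_pi; apply/(idealN hK)/(ideal_piM hK hpi).
  by rewrite subrr; case: eqP => _; [right; rewrite (ord_1 hK) | exact: ideal0].
have /(_ i0)[_] : D (a *: w i0) by rewrite DE; exists (w i0).
case: fam => uw _ ww.
rewrite formZl formDr ww formZr eqxx mul1r add0r (formC alt) uw eqxx mulr1.
rewrite (ideal_ordM hK) // orda subr0 (idealN hK).
by move=> /(idealE ord _ (piX_neq0 hpi s)); rewrite (ord_piX hK hpi); lia.
Qed.

(** * Special vertices and their neighbours *)

Lemma self_dual_form_in m s L : self_dual s L -> m <= s -> form_in ord B m L.
Proof.
by move=> sd ms x y Lx Ly; apply: (ideal_le ms); apply: self_dual_form Lx Ly.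
Qed.

Lemma self_dual_primitive L : self_dual 0 L -> is_primitive ord pi B L.
Proof.
move=> sd; split; first exact: self_dual_lattice sd.
  by apply: (self_dual_form_in sd).
move=> x Lx h; apply/scale_setE; first exact: pi_neq0 hpi.
apply/(self_dualP sd) => y Ly.
rewrite formZl -ideal_pi mulVKf ?(pi_neq0 hpi) //.
by rewrite add0r; apply: h.
Qed.

Lemma normalize_scale s : exists k : int, s + k *+ 2 = 0 \/ s + k *+ 2 = 1.
Proof.
exists (- (s %/ 2)%Z); rewrite {1 3}(divz_eq s 2) mulNrn -mulr_natr.
have := ltz_pmod s (isT : (0 : int) < 2).
have := modz_ge0 s (isT : (2 : int) != 0).
set q := (s %/ 2)%Z; set r := (s %% 2)%Z; lia.
Qed.

(** After scaling, s is 0 or 1. If s = 0, then L is primitive and the chain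
pi L, C, L shows the incidence. If s = 1, then pi^-1 C is primitive and the
chain is C, L, pi^-1 C. *)
Lemma child_incident s L C : self_dual s L -> self_dual (s + 1) C ->
    scale_set pi L `<=` C -> C `<=` L ->
  building_vertex ord pi B (homothety_class L) /\
  incident ord pi B (homothety_class L) (homothety_class C).
Proof.
move=> sdL0 sdC0 LC0 CL0; have [k ks] := normalize_scale s.
have pi0 := pi_neq0 hpi; have pik0 := piX_neq0 hpi k.
rewrite -(homothety_scale L pik0) -(homothety_scale C pik0).
have := self_dual_piX k sdL0; have := self_dual_piX k sdC0.
have := scale_subset (a := pi ^ k) LC0; have := scale_subset (a := pi ^ k) CL0.
rewrite scale_setM mulrC -scale_setM addrAC.
move: (scale_set _ L) (scale_set _ C) (s + _) ks => {s sdL0 sdC0 LC0 CL0}.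
move=> {}L {}C s s01 CL LC sdC sdL.
have sdpiL := self_dual_piX 1 sdL; rewrite expr1z in sdpiL.
have piLL : scale_set pi L `<=` L by apply: subset_trans LC CL.
case: s01 => s_eq; rewrite {}s_eq in sdL sdC sdpiL.
  have primL := self_dual_primitive sdL; split.
    exists (scale_set pi L), L; split=> //.
    - exact: self_dual_lattice sdpiL.
    - by rewrite homothety_scale.
    - by apply: (self_dual_form_in sdpiL).
    - by split.
  exists (scale_set pi L), C, L; split=> //.
  - by split; [rewrite -(homothety_scale L pi0)|]; apply: homothety_refl.
  - by apply: (self_dual_form_in sdpiL).
  - by apply: (self_dual_form_in sdC).
  - by left; split.
pose L0 := scale_set pi^-1 C.
have primL0 : is_primitive ord pi B L0.
  by apply: self_dual_primitive; apply: (self_dual_piX (-1) sdC).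
have piL0 : scale_set pi L0 = C by rewrite scale_setM mulfV // scale_set1.
have LL0 : L `<=` L0.
  move=> x Lx; apply/scale_setE; rewrite ?invr_eq0 // invrK.
  by apply: LC; exists x.
split.
  exists L, L0; split=> //; rewrite ?piL0 //.
    exact: self_dual_lattice sdL.
  by apply: (self_dual_form_in sdL).
exists L, C, L0; split=> //; rewrite ?piL0.
- by split; apply: homothety_refl.
- by apply: (self_dual_form_in sdL).
- by apply: (self_dual_form_in sdC).
- by right; split.
Qed.

(** The classes differ: the scales s and s + 1 have different parities. *)
Lemma child_adjacent s L C : self_dual s L -> self_dual (s + 1) C ->
    scale_set pi L `<=` C -> C `<=` L ->
  adjacent ord pi B (homothety_class L) (homothety_class C).
Proof.
move=> sdL sdC LC CL; split; last by have [] := child_incident sdL sdC LC CL.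
move=> LCE; have : homothety_class L C by rewrite LCE; apply: homothety_refl.
case=> a /eqP a0 CE; have := self_dual_scale a0 sdL; rewrite -CE.
by move=> /(self_dual_uniq sdC); rewrite mulr2n; lia.
Qed.

(** In an adapted symplectic family u, w of scale s, the basis u, pi^-s w is
symplectic, and L has the exponents a_i = 0 and b_i = s in it. *)
Lemma self_dual_special s L : self_dual s L ->
  special_vertex ord pi B n (homothety_class L).
Proof.
move=> sd; have [U isoU dimU] := exists_lagrangian.
have [C [_ [[sdC LC CL _] _ _]]] := two_child_lattices isoU dimU sd.
split; first by have [] := child_incident sd sdC LC CL.
have [u [w [fam _ LE]]] := Iwasawa isoU dimU sd.
have s0 := piX_neq0 hpi s.
pose tu := mktuple u; pose tw := [tuple (pi ^ s)^-1 *: w i | i < n].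
exists L, tu, tw, (fun=> 0), (fun=> s).
have [uw uu ww] := fam.
have fam1 : symplectic_family B 1 (tnth tu) (tnth tw).
  split=> i j; rewrite !tnth_mktuple ?formZl ?formZr ?uu ?ww ?uw ?mulr0 //.
  by rewrite mulKf ?mul1r.
split=> //.
- exact: homothety_refl.
- split; first exact: (family_basis alt (oner_neq0 K) dimV fam1).
  + by move=> i j; case: fam1 => -> _ _; rewrite mul1r.
  + by case: fam1.
  + by case: fam1.
- have -> : (fun i => pi ^ (0 : int) *: tnth tu i) = u.
    by apply/funext => i; rewrite tnth_mktuple expr0z scale1r.
  have -> : (fun i => pi ^ s *: tnth tw i) = w.
    by apply/funext => i; rewrite tnth_mktuple scalerA mulfV ?scale1r.
  by rewrite LE; apply: family_latticeP.
Qed.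

(** The common value of a_i + b_i is the scale. *)
Lemma special_self_dual t : special_vertex ord pi B n t ->
  exists s L, self_dual s L /\ t = homothety_class L.
Proof.
case=> -[L1 [_ [_ -> _ _ _]]] [L [u [w [a [b [tL [_ uw uu ww] LE ab]]]]]].
pose s := a (Ordinal n_gt0) + b (Ordinal n_gt0).
exists s, L; split; last by rewrite (homothety_classE tL).
have fam : family s (fun i => pi ^ a i *: tnth u i)
                    (fun i => pi ^ b i *: tnth w i).
  split=> i j; rewrite formZl formZr ?uu ?ww ?uw ?mulr0 //.
  case: eqP => [<-|_]; rewrite ?mulr0 // !mulr1 -expfzDr ?(pi_neq0 hpi) //.
  by congr (_ ^ _); apply: ab.
by rewrite LE -(family_latticeP fam); apply: family_lattice_self_dual.
Qed.

End Lattices.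

(** * Non-amenability *)

Theorem corollary2p8 (R : realType) (K : fieldType) (ord : K -> int) (pi : K)
    (n : nat) (V : vectType K) (B : {biscalar V}) :
  (2 <= n)%N ->
  is_local_field ord ->
  is_uniformizer ord pi ->
  \dim {:V} = (2 * n)%N ->
  alternating B ->
  nondegenerate_form B ->
  ~ amenable (special_graph ord pi B n) R.
Proof.
move=> n2 hK hpi dimV alt nondeg; have n_gt0 : (0 < n)%N by apply: ltnW.
have [U isoU dimU] := exists_lagrangian dimV alt.
pose X := special_graph ord pi B n.
have special s L : self_dual ord pi B s L ->
    exists t : X, val t = homothety_class L.
  move=> sd; have := self_dual_special hK hpi dimV n_gt0 alt nondeg sd.
  move=> /mem_set tX.
  by exists (exist (fun t => t \in special_vertices ord pi B n) _ tX).
apply: (@not_amenable_parent X (set (set V))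
          (fun t => parent_lattice pi U @` val t) val val_inj); last first.
  have [u [w fam]] := exists_symplectic_family alt nondeg isoU dimU.
  have fam0 : symplectic_family B (pi ^ 0) u w by rewrite expr0z.
  have sd := family_lattice_self_dual hK hpi dimV alt nondeg fam0.
  by have [x _] := special _ _ sd; constructor.
move=> [t tX].
have /set_mem/(special_self_dual hK hpi dimV n_gt0 alt nondeg) := tX.
move=> [s [L [sd tE]]].
have [C [D [chC chD CD]]] :=
  two_child_lattices hK hpi dimV n_gt0 alt nondeg isoU dimU sd.
have parentE M : is_child ord pi B U s L M ->
    parent_lattice pi U @` homothety_class M = t.
  case=> _ _ _ PM; rewrite tE -(homothety_scale L (pi_neq0 hpi)) -PM.
  apply/seteqP; split=> [_ [_ [a /eqP a0 ->] <-] | _ [a /eqP a0 ->]].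
    by exists a; [exact/eqP | rewrite parent_lattice_scale].
  exists (scale_set a M); first by exists a; [exact/eqP|].
  by rewrite parent_lattice_scale.
have adj M : is_child ord pi B U s L M ->
    adjacent ord pi B t (homothety_class M).
  case=> sdM LM ML _; rewrite tE.
  exact: (child_adjacent hK hpi dimV n_gt0 alt nondeg sd sdM).
have [[sdC _ _ _] [sdD _ _ _]] := (chC, chD).
have [[x xC] [y yD]] := (special _ _ sdC, special _ _ sdD).
exists x, y; rewrite xC yD; split.
- by apply/asboolP; rewrite xC; apply: adj.
- by apply/asboolP; rewrite yD; apply: adj.
- by move=> xy; apply: CD; rewrite -xC xy yD; apply: homothety_refl.
- exact: parentE.
- exact: parentE.
Qed.
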